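(* Let $G$ and $H$ be two graphs of order $n_1$ and $n_2\ge 2$, respectively. Then $$\gamma_R(G\odot H)=2n_1.$$
   Context: All graphs are finite, undirected, without loops or multiple edges. The order of a graph is its number of vertices. For graphs $G$ and $H$, where $G$ has vertices $v_1,\dots,v_{n_1}$, the corona graph $G\odot H$ is obtained from one copy of $G$ and $n_1$ copies of $H$ by joining by an edge each vertex of the $i$-th copy of $H$ with the vertex $v_i$ of $G$. A Roman dominating function on a graph with vertex set $V$ is a map $f:V\to\{0,1,2\}$ such that every vertex $v$ with $f(v)=0$ has a neighbor $u$ with $f(u)=2$; its weight is $f(V)=\sum_{u\in V}f(u)$. The Roman domination number $\gamma_R(G)$ is the minimum weight of a Roman dominating function on $G$. *)

(* Defs.v *)
From HB Require Import structures.
From mathcomp Require Import all_boot.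

Set Implicit Arguments.
Unset Strict Implicit.
Unset Printing Implicit Defensive.

(* Finite simple graphs; the vertex set may be empty. *)
Record sgraph := SGraph {
  vertex :> finType;
  adj : rel vertex;
  adj_sym : symmetric adj;
  adj_irrefl : irreflexive adj
}.

Section Corona.
Variables G H : sgraph.

(* [inl v] is the vertex v of G; [inr (v, x)] is the vertex x of the copy of H
   attached to v. *)
Definition corona_adj (a b : G + G * H) : bool :=
  match a, b with
  | inl u, inl v => adj u v
  | inl u, inr (v, _) => u == v
  | inr (u, _), inl v => u == v
  | inr (u, x), inr (v, y) => (u == v) && adj x y
  end.

Lemma corona_adj_sym : symmetric corona_adj.
Proof.
by case=> [u|[u x]] [v|[v y]] //=; rewrite ?[u == v]eq_sym // adj_sym.
Qed.

Lemma corona_adj_irrefl : irreflexive corona_adj.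
Proof. by case=> [u|[u x]] /=; rewrite adj_irrefl ?andbF. Qed.

Definition corona : sgraph := SGraph corona_adj_sym corona_adj_irrefl.

End Corona.

Section RomanDomination.
Variable G : sgraph.
Implicit Type f : {ffun G -> 'I_3}.

Definition roman_dominating f : bool :=
  [forall v, (f v == 0 :> nat) ==> [exists u, adj v u && (f u == 2 :> nat)]].

Definition weight f : nat := \sum_(u : G) f u.

Definition roman_weight (n : nat) : bool :=
  [exists f, roman_dominating f && (weight f == n)].

Lemma roman_weight_ex : exists n, roman_weight n.
Proof.
exists (weight [ffun _ => ord_max]); apply/existsP; exists [ffun _ => ord_max].
by rewrite eqxx andbT; apply/forallP=> v; rewrite ffunE.
Qed.

Definition roman_domination_number : nat := ex_minn roman_weight_ex.

End RomanDomination.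

(* Main.v *)
Require Import Defs.
From mathcomp Require Import all_boot.

(** The corona splits into blocks, one for each vertex [v] of [G] together with its copy of [H]. A
    copy vertex has all its neighbours in its own block, so each block weighs at least 2
    ([corona_fiber_weight_ge2]). Value 2 on [G] and 0 on the copies attains this bound in every
    block. *)

Lemma corona_weightE (G H : sgraph) (f : {ffun corona G H -> 'I_3}) :
  weight f = \sum_(v : G) (f (inl v) + \sum_(x : H) f (inr (v, x))).
Proof.
rewrite /weight big_sumType /= big_split /=; congr (_ + _).
by rewrite pair_bigA /=; apply: eq_bigr => -[].
Qed.

(* A vertex of weight 0 in the copy of H at v is dominated from that copy or
   from v itself; without such a vertex the copy weighs at least #|H|. *)
Lemma corona_fiber_weight_ge2 (G H : sgraph) (f : {ffun corona G H -> 'I_3})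
    (v : G) :
  2 <= #|H| -> roman_dominating f ->
  2 <= f (inl v) + \sum_(x : H) f (inr (v, x)).
Proof.
move=> H2 /forallP fdom.
case: (boolP [exists x : H, f (inr (v, x)) == 0 :> nat]) => [/existsP[x fx0]|].
  have /implyP/(_ fx0)/existsP[[u|[u y]] /=] := fdom (inr (v, x)).
    by move=> /andP[/eqP<- /eqP->]; apply: leq_addr.
  move=> /andP[/andP[/eqP<- _] /eqP fy2].
  by rewrite (bigD1 y) //= fy2 addnCA leq_addr.
rewrite negb_exists => /forallP fpos.
apply: leq_trans H2 (leq_trans _ (leq_addl _ _)).
by rewrite -sum1_card; apply: leq_sum => x _; rewrite lt0n.
Qed.

Theorem theorem9 (G H : sgraph) (n1 n2 : nat)
    (hG : #|G| = n1) (hH : #|H| = n2) (hn2 : 2 <= n2) :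
  roman_domination_number (corona G H) = 2 * n1.
Proof.
(* With the target written as a sum of 2 over [G], both bounds reduce to a comparison block by
   block. *)
rewrite -hG mulnC -sum_nat_const /roman_domination_number.
case: ex_minnP => m /existsP[f /andP[fdom /eqP<-]] fmin.
apply/eqP; rewrite eqn_leq; apply/andP; split; last first.
  rewrite corona_weightE; apply: leq_sum => v _.
  by apply: corona_fiber_weight_ge2; rewrite ?hH.
apply: fmin; apply/existsP.
pose g : {ffun corona G H -> 'I_3} :=
  [ffun a => if a is inl _ then inord 2 else inord 0].
exists g; apply/andP; split.
  apply/forallP => -[v|[v x]]; rewrite ffunE inordK //=.
  (* Only copy vertices get value 0, and each is dominated by the vertex of [G] its copy is attached
     to. *)
  by apply/existsP; exists (inl v); rewrite ffunE inordK //= eqxx.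
rewrite corona_weightE; apply/eqP; apply: eq_bigr => v _.
by rewrite ffunE inordK // big1 // => x _; rewrite ffunE inordK.
Qed.
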